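(* Let $\mathcal{X}=(\mathcal{V},\varrho,\upsilon)$ be a fuzzy graph with strong domination number $\gamma_s(\mathcal{X})$ and upper strong domination number $\Gamma_s(\mathcal{X})$, and let $n=|\varrho^*|$. Then $$\gamma_s(\mathcal{X})\le\frac{SDI(\mathcal{X})}{n}\le\Gamma_s(\mathcal{X}).$$
   Context: A fuzzy graph $\mathcal{X}=(\mathcal{V},\varrho,\upsilon)$ consists of a nonempty finite set $\mathcal{V}$ of vertices, a function $\varrho:\mathcal{V}\to[0,1]$ and a symmetric function $\upsilon:\mathcal{V}\times\mathcal{V}\to[0,1]$ with $\upsilon(ab)\le\min(\varrho(a),\varrho(b))$ for all $a,b$, and no loops ($\upsilon(aa)=0$). Put $\varrho^*=\{a:\varrho(a)>0\}$ and $\upsilon^*=\{ab:\upsilon(ab)>0\}$; it is assumed that $\mathcal{V}=\varrho^*$, and the elements of $\upsilon^*$ are called edges. A path is a sequence of distinct vertices $a_1,\dots,a_m$ with $\upsilon(a_ia_{i+1})>0$ for all $i<m$; its strength is the minimum of the weights $\upsilon$ of its edges. The strength of connectedness between $a$ and $b$ is the maximum of the strengths of all paths from $a$ to $b$ (and $0$ if there is none). An edge $ab$ is strong if $\upsilon(ab)$ is at least the strength of connectedness between $a$ and $b$ in the fuzzy graph obtained by deleting the edge $ab$. A set $\mathcal{D}\subseteq\mathcal{V}$ is a strong dominating set (SDS) if every $b\in\mathcal{V}\setminus\mathcal{D}$ is joined by a strong edge to some $a\in\mathcal{D}$. An SDS $\mathcal{D}$ is a minimal strong dominating set (MSDS)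 if $\mathcal{D}\setminus\{a\}$ is not an SDS for every $a\in\mathcal{D}$. The weight of $\mathcal{S}\subseteq\mathcal{V}$ is $W(\mathcal{S})=\sum_{a\in\mathcal{S}}\min\{\upsilon(ab): ab \text{ is a strong edge}\}$; whenever weights are used it is understood that every vertex is incident with at least one strong edge. The strong domination number $\gamma_s(\mathcal{X})$ is the minimum weight of an SDS; the upper strong domination number $\Gamma_s(\mathcal{X})$ is the maximum weight of an MSDS; the strong domination degree ${}_{sd}d(u)$ of a vertex $u$ is the minimum of the weights of the MSDSs containing $u$; the strong domination index is $SDI(\mathcal{X})=\sum_{v\in\mathcal{V}}{}_{sd}d(v)$. *)

(* Defs.v *)
From HB Require Import structures.
From mathcomp Require Import all_boot all_order all_algebra.

Set Implicit Arguments.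
Unset Strict Implicit.
Unset Printing Implicit Defensive.

Import Order.TTheory GRing.Theory Num.Theory.
Local Open Scope ring_scope.

Record fuzzy_graph (R : realFieldType) (V : finType) := FuzzyGraph {
  rho : V -> R;
  ups : V -> V -> R;
  vertices_nonempty : (0 < #|V|)%N;
  rho_unit : forall a, 0 <= rho a <= 1;
  ups_unit : forall a b, 0 <= ups a b <= 1;
  ups_sym : forall a b, ups a b = ups b a;
  ups_le_min : forall a b, ups a b <= Num.min (rho a) (rho b);
  ups_noloop : forall a, ups a a = 0
}.

Section FuzzyGraph.
Variables (R : realFieldType) (V : finType).
Implicit Types (X : fuzzy_graph R V) (a b u : V) (D : {set V}).

Definition rho_supp X : {set V} := [set a | 0 < rho X a].

Definition is_edge X : rel V := fun a b => 0 < ups X a b.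

Definition del_ups X a b : V -> V -> R := fun x y =>
  if ((x == a) && (y == b)) || ((x == b) && (y == a)) then 0 else ups X x y.

Lemma del_ups_unit X a b x y : 0 <= del_ups X a b x y <= 1.
Proof. by rewrite /del_ups; case: ifP => _; rewrite ?lexx ?ler01 ?ups_unit. Qed.

Lemma del_ups_sym X a b x y : del_ups X a b x y = del_ups X a b y x.
Proof. by rewrite /del_ups orbC (andbC (x == b)) (andbC (x == a)) ups_sym. Qed.

Lemma del_ups_le_min X a b x y :
  del_ups X a b x y <= Num.min (rho X x) (rho X y).
Proof.
rewrite /del_ups; case: ifP => _; last exact: ups_le_min.
by rewrite le_min; case/andP: (rho_unit X x) => -> _; case/andP: (rho_unit X y).
Qed.

Lemma del_ups_noloop X a b x : del_ups X a b x x = 0.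
Proof. by rewrite /del_ups ups_noloop; case: ifP. Qed.

Definition del_edge X a b : fuzzy_graph R V :=
  FuzzyGraph (vertices_nonempty X) (rho_unit X) (del_ups_unit X a b)
    (del_ups_sym X a b) (del_ups_le_min X a b) (del_ups_noloop X a b).

(* The path a_1, ..., a_m is encoded by its first vertex a = a_1 and its tail
   p = [:: a_2; ...; a_m], as in the library's [path]. *)
Definition is_path X a b (p : seq V) : bool :=
  [&& path (is_edge X) a p, last a p == b & uniq (a :: p)].

(* Minimum over the edges of the path; all weights are at most 1, so the initial
   value 1 only matters for the one-vertex path, which has no edge. *)
Definition path_strength X a (p : seq V) : R :=
  \big[Num.min/1]_(e <- zip (a :: p) p) ups X e.1 e.2.

(* The vertices of a path are distinct, so its tail has length at most #|V| and
   the sequences of length at most #|V| include every path. *)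
Definition conn_strength X a b : R :=
  \big[Num.max/0]_(p : #|V|.-bseq V | is_path X a b p) path_strength X a p.

Definition strong_edge X : rel V := fun a b =>
  is_edge X a b && (conn_strength (del_edge X a b) a b <= ups X a b).

Definition sds X D : bool :=
  [forall b, (b \notin D) ==> [exists a in D, strong_edge X a b]].

Definition msds X D : bool := sds X D && [forall a in D, ~~ sds X (D :\ a)].

(* The initial value 1 is irrelevant as soon as a has a strong edge. *)
Definition vertex_weight X a : R :=
  \big[Num.min/1]_(b | strong_edge X a b) ups X a b.

Definition weight X D : R := \sum_(a in D) vertex_weight X a.

(* Weights are nonnegative, hence monotone in D: the initial values below
   (weight of the full set for minima, 0 for maxima) do not affect the extremum
   of a nonempty family.  The full set is an SDS, and every vertex u lies in an
   MSDS: a maximal set containing u with no two vertices joined by a strong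
   edge. *)
Definition strong_dom_number X : R :=
  \big[Num.min/weight X setT]_(D : {set V} | sds X D) weight X D.

Definition upper_strong_dom_number X : R :=
  \big[Num.max/0]_(D : {set V} | msds X D) weight X D.

Definition strong_dom_degree X u : R :=
  \big[Num.min/weight X setT]_(D : {set V} | msds X D && (u \in D)) weight X D.

Definition strong_dom_index X : R := \sum_(v : V) strong_dom_degree X v.

End FuzzyGraph.

(* Main.v *)
(** Strong adjacency is symmetric, because reversing a path preserves its
    strength; hence a maximal strongly independent set containing [u] is a
    minimal strong dominating set containing [u].  So every [sd d(u)] is the
    weight of an actual MSDS and lies between the two domination numbers; average
    over the vertices. *)

Require Import Defs.
From HB Require Import structures.
From mathcomp Require Import all_boot all_order all_algebra.

Set Implicit Arguments.
Unset Strict Implicit.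
Unset Printing Implicit Defensive.

Import Order.TTheory GRing.Theory Num.Theory.
Local Open Scope ring_scope.

(** Trades a minimum for its lower bounds, which form a [path] predicate, so that the list lemmas on
    reversal apply. The conjunct [t <= 1] comes from the initial value 1. *)
Lemma le_path_strength (R : realFieldType) (V : finType) (X : fuzzy_graph R V)
    (t : R) a p :
  (t <= path_strength X a p) = (t <= 1) && path (fun x y => t <= ups X x y) a p.
Proof.
rewrite /path_strength; elim: p a => [|c p IHp] a /=.
  by rewrite big_nil andbT.
by rewrite big_cons le_min IHp andbCA.
Qed.

(** Two graphs appear because [del_edge X a b] and [del_edge X b a] are different records whose
    weights agree only pointwise. *)
Lemma path_strength_rev (R : realFieldType) (V : finType) (X Y : fuzzy_graph R V)
    a p : ups X =2 ups Y ->
  path_strength X a p = path_strength Y (last a p) (rev (belast a p)).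
Proof.
move=> eqXY; apply: le_anti.
(* Two elements with the same lower bounds are equal. *)
have eqE t : (t <= path_strength X a p) =
             (t <= path_strength Y (last a p) (rev (belast a p))).
  rewrite !le_path_strength rev_path; congr (_ && _).
  by apply: eq_path => x y; rewrite ups_sym eqXY.
by rewrite -eqE lexx eqE lexx.
Qed.

Lemma is_path_rev (R : realFieldType) (V : finType) (X Y : fuzzy_graph R V)
    a b p : ups X =2 ups Y ->
  is_path X a b p -> is_path Y b a (rev (belast a p)).
Proof.
move=> eqXY /and3P[pathp /eqP <- uniqp]; apply/and3P; split.
- rewrite rev_path (eq_path (e' := is_edge X)) // => x y.
  by rewrite /is_edge -eqXY ups_sym.
- by case: (p) => [|c q] //=; rewrite rev_cons last_rcons.
- by rewrite -rev_rcons -lastI rev_uniq.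
Qed.

Lemma conn_strength_le_rev (R : realFieldType) (V : finType)
    (X Y : fuzzy_graph R V) a b : ups X =2 ups Y ->
  conn_strength X a b <= conn_strength Y b a.
Proof.
move=> eqXY; apply: bigmax_le => [|p pathp]; first exact: bigmax_ge_id.
(* The reversed tail loses the endpoint [b] and gains [a], so its length is unchanged and it still
   indexes the maximum. *)
have size_rev_p : (size (rev (belast a p)) <= #|V|)%N.
  by rewrite size_rev size_belast size_bseq.
rewrite (path_strength_rev _ _ eqXY); case/and3P: (pathp) => _ /eqP -> _.
apply: (@le_bigmax_cond _ _ _ _ (Bseq size_rev_p)
  (fun q : #|V|.-bseq V => is_path Y b a q)
  (fun q : #|V|.-bseq V => path_strength Y b q)).
exact: is_path_rev eqXY pathp.
Qed.

Lemma strong_edge_sym (R : realFieldType) (V : finType) (X : fuzzy_graph R V) :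
  symmetric (strong_edge X).
Proof.
suff imp a b : strong_edge X a b -> strong_edge X b a.
  by move=> a b; apply/idP/idP; apply: imp.
rewrite /strong_edge /is_edge (ups_sym X a b) => /andP[-> /=].
apply: le_trans; apply: conn_strength_le_rev => x y /=.
by rewrite /del_ups orbC.
Qed.

Lemma strong_edgexx (R : realFieldType) (V : finType) (X : fuzzy_graph R V) a :
  strong_edge X a a = false.
Proof. by rewrite /strong_edge /is_edge ups_noloop ltxx. Qed.

Definition strong_indep (R : realFieldType) (V : finType) (X : fuzzy_graph R V)
    (D : {set V}) : bool :=
  [forall a in D, forall b in D, ~~ strong_edge X a b].

Lemma strong_indepP (R : realFieldType) (V : finType) (X : fuzzy_graph R V)
    (D : {set V}) :
  reflect {in D &, forall a b, ~~ strong_edge X a b} (strong_indep X D).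
Proof.
apply: (iffP forall_inP) => [indD a b aD bD | indD a aD].
  exact: (forall_inP (indD a aD)).
by apply/forall_inP => b; apply: indD.
Qed.

Lemma maxset_strong_indep_msds (R : realFieldType) (V : finType)
    (X : fuzzy_graph R V) (D : {set V}) :
  maxset (strong_indep X) D -> msds X D.
Proof.
case/maxsetP => /strong_indepP indD maxD; apply/andP; split.
  apply/forallP => b; apply/implyP => bD; apply: contraR bD => /exists_inPn nob.
  (* If [b] has no strong neighbour in [D], then [b |: D] is still independent, so maximality puts
     [b] in [D]. *)
  rewrite -(maxD (b |: D)) ?setU11 ?subsetUr //.
  apply/strong_indepP => x y /setU1P[->|xD] /setU1P[->|yD].
  - by rewrite strong_edgexx.
  - by rewrite strong_edge_sym nob.
  - exact: nob.
  - exact: indD.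
(* Once [a] is removed, [a] itself is undominated: a strong neighbour in [D] would break
   independence. *)
apply/forall_inP => a aD; apply/negP => /forallP/(_ a).
rewrite setD11 /= => /exists_inP[c /setD1P[_ cD]].
exact/negP/indD.
Qed.

Lemma msds_exists (R : realFieldType) (V : finType) (X : fuzzy_graph R V) u :
  exists2 D : {set V}, msds X D & u \in D.
Proof.
have indu : strong_indep X [set u].
  by apply/strong_indepP => x y /set1P-> /set1P->; rewrite strong_edgexx.
have [D maxD uD] := maxset_exists indu.
by exists D; [apply: maxset_strong_indep_msds | rewrite -sub1set].
Qed.

Lemma strong_dom_number_le_degree (R : realFieldType) (V : finType)
    (X : fuzzy_graph R V) u :
  strong_dom_number X <= strong_dom_degree X u.
Proof.
(* Both minima start from the weight of the full set, which settles the default case. *)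
apply: le_bigmin => [|D /andP[/andP[sdsD _] _]]; first exact: bigmin_le_id.
exact: bigmin_le_cond.
Qed.

Lemma strong_dom_degree_le_upper (R : realFieldType) (V : finType)
    (X : fuzzy_graph R V) u :
  strong_dom_degree X u <= upper_strong_dom_number X.
Proof.
(* An actual MSDS through [u] bounds the degree by more than its default value. *)
have [D msdsD uD] := msds_exists X u.
apply: (@le_trans _ _ (weight X D)).
  by apply: bigmin_le_cond; rewrite msdsD.
exact: le_bigmax_cond.
Qed.

Theorem theorem4p3 (R : realFieldType) (V : finType) (X : fuzzy_graph R V)
  (supp_full : rho_supp X = [set: V])
  (has_strong : forall a : V, exists b : V, strong_edge X a b) :
  strong_dom_number X <= strong_dom_index X / #|rho_supp X|%:R /\
  strong_dom_index X / #|rho_supp X|%:R <= upper_strong_dom_number X.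
Proof.
have n_gt0 : 0 < #|V|%:R :> R by rewrite ltr0n (vertices_nonempty X).
(* With the denominator cleared, each bound becomes a constant sum, to be compared term by term with
   the index. *)
have sum_const c : c * #|V|%:R = \sum_(v : V) c :> R.
  by rewrite sumr_const mulr_natr.
rewrite supp_full cardsT ler_pdivlMr // ler_pdivrMr // !sum_const.
split; apply: ler_sum => u _.
  exact: strong_dom_number_le_degree.
exact: strong_dom_degree_le_upper.
Qed.
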